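(* Let $s,M$ be positive integers and $r$ a non-negative integer with $s+r\le M$. Then, as formal power series in $x,q$, \[ \frac{1}{(xq^s,xq^{s+r};q^M)_\infty}=\sum_{j\ge0}\frac{x^jq^{sj}}{(q^{2M};q^{2M})_{\lfloor j/2\rfloor}}\sum_{i=0}^{\lfloor j/2\rfloor}{\lfloor j/2\rfloor\brack i}_{q^{2M}}\frac{(-q^r;q^{2M})_{i+\lceil j/2\rceil-\lfloor j/2\rfloor}(-q^{M+r};q^{2M})_i}{(q^M;q^{2M})_{i+\lceil j/2\rceil-\lfloor j/2\rfloor}}(q^{2r})^{\lfloor j/2\rfloor-i}. \]
   Context: $(a;p)_k=\prod_{i=0}^{k-1}(1-ap^i)$, $(a;p)_\infty=\prod_{i\ge0}(1-ap^i)$, $(a,b;p)_\infty=(a;p)_\infty(b;p)_\infty$. For integers $0\le B\le A$, ${A\brack B}_p=\frac{(p;p)_A}{(p;p)_B(p;p)_{A-B}}$. $\lfloor\cdot\rfloor,\lceil\cdot\rceil$ are floor and ceiling. (The left side is the generating function, with $x$ counting parts, of partitions into parts congruent to $s$ or $s+r$ modulo $M$.) *)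

(* Defs.v *)
From HB Require Import structures.
From mathcomp Require Import all_boot all_order all_algebra.
From mathcomp Require Import boolp classical_sets.
Set Implicit Arguments.
Unset Strict Implicit.
Unset Printing Implicit Defensive.
Import GRing.Theory.
Local Open Scope ring_scope.

Record fps (R : Type) := Fps { fps_coef : nat -> R }.
Notation "{ 'fps' R }" := (fps R%type) (format "{ 'fps'  R }") : type_scope.

HB.instance Definition _ (R : Type) := gen_eqMixin {fps R}.
HB.instance Definition _ (R : Type) := gen_choiceMixin {fps R}.

Lemma fpsP (R : Type) (f g : {fps R}) :
  (forall n, fps_coef f n = fps_coef g n) -> f = g.
Proof. by case: f g => [f] [g] /= fg; congr Fps; apply: funext. Qed.

Section FpsRing.
Variable R : comUnitRingType.
Implicit Types f g h : {fps R}.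

Definition fps0 : {fps R} := Fps (fun=> 0).
Definition fps_opp f : {fps R} := Fps (fun n => - fps_coef f n).
Definition fps_add f g : {fps R} := Fps (fun n => fps_coef f n + fps_coef g n).
Definition fpsC (c : R) : {fps R} := Fps (fun n => if n == 0%N then c else 0).
Definition fpsX : {fps R} := Fps (fun n => (n == 1%N)%:R).
Definition fps_mul f g : {fps R} :=
  Fps (fun n => \sum_(i < n.+1) fps_coef f i * fps_coef g (n - i)).

Fact fps_addA : associative fps_add.
Proof. by move=> f g h; apply: fpsP => n /=; rewrite addrA. Qed.
Fact fps_addC : commutative fps_add.
Proof. by move=> f g; apply: fpsP => n /=; rewrite addrC. Qed.
Fact fps_add0 : left_id fps0 fps_add.
Proof. by move=> f; apply: fpsP => n /=; rewrite add0r. Qed.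
Fact fps_addN : left_inverse fps0 fps_opp fps_add.
Proof. by move=> f; apply: fpsP => n /=; rewrite addNr. Qed.

HB.instance Definition _ :=
  GRing.isZmodule.Build {fps R} fps_addA fps_addC fps_add0 fps_addN.

Definition fps_trunc N f : {poly R} := \poly_(i < N) fps_coef f i.

Lemma coef_fps_trunc N f n : (n < N)%N -> (fps_trunc N f)`_n = fps_coef f n.
Proof. by move=> nN; rewrite coef_poly nN. Qed.

Lemma fps_coef_mul_trunc N f g n : (n < N)%N ->
  fps_coef (fps_mul f g) n = (fps_trunc N f * fps_trunc N g)`_n.
Proof.
move=> nN; rewrite coefM /=; apply: eq_bigr => i _.
have iN : (i < N)%N by apply: leq_ltn_trans nN; rewrite -ltnS.
rewrite !coef_fps_trunc //; exact: leq_ltn_trans (leq_subr _ _) nN.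
Qed.

Fact fps_mulC : commutative fps_mul.
Proof.
by move=> f g; apply: fpsP => n; rewrite !(@fps_coef_mul_trunc n.+1) // mulrC.
Qed.

Fact fps_mulA : associative fps_mul.
Proof.
move=> f g h; apply: fpsP => n.
transitivity (fps_trunc n.+1 f * (fps_trunc n.+1 g * fps_trunc n.+1 h))`_n.
  rewrite coefM [LHS]/=; apply: eq_bigr => i _.
  by rewrite coef_fps_trunc // -fps_coef_mul_trunc // ltnS leq_subr.
rewrite mulrA coefM [RHS]/=; apply: eq_bigr => i _.
by rewrite coef_fps_trunc ?ltnS ?leq_subr // -fps_coef_mul_trunc.
Qed.

Fact fps_mul1 : left_id (fpsC 1) fps_mul.
Proof.
move=> f; apply: fpsP => n /=; rewrite big_ord_recl /= mul1r subn0.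
by rewrite big1 ?addr0 // => i _; rewrite mul0r.
Qed.

Fact fps_mulDl : left_distributive fps_mul fps_add.
Proof.
move=> f g h; apply: fpsP => n /=; rewrite -big_split /=.
by apply: eq_bigr => i _; rewrite mulrDl.
Qed.

Fact fps_oner_neq0 : fpsC 1 != 0.
Proof.
apply/eqP => /(congr1 (fun f => fps_coef f 0%N)) /= /eqP.
by rewrite oner_eq0.
Qed.

HB.instance Definition _ := GRing.Zmodule_isComNzRing.Build {fps R}
  fps_mulA fps_mulC fps_mul1 fps_mulDl fps_oner_neq0.

Lemma fps_coef0 n : fps_coef (0 : {fps R}) n = 0. Proof. by []. Qed.
Lemma fps_coef1 n : fps_coef (1 : {fps R}) n = (n == 0%N)%:R.
Proof. by case: n. Qed.
Lemma fps_coefN f n : fps_coef (- f) n = - fps_coef f n. Proof. by []. Qed.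
Lemma fps_coefD f g n : fps_coef (f + g) n = fps_coef f n + fps_coef g n.
Proof. by []. Qed.
Lemma fps_coefB f g n : fps_coef (f - g) n = fps_coef f n - fps_coef g n.
Proof. by []. Qed.
Lemma fps_coefM f g n :
  fps_coef (f * g) n = \sum_(i < n.+1) fps_coef f i * fps_coef g (n - i).
Proof. by []. Qed.

Lemma fps_coefMX f n :
  fps_coef (f * fpsX) n = if n is m.+1 then fps_coef f m else 0.
Proof.
rewrite mulrC fps_coefM big_ord_recl /= mul0r add0r.
case: n => [|n]; first by rewrite big_ord0.
rewrite big_ord_recl /= mul1r subSS subn0 big1 ?addr0 // => i _.
by rewrite mul0r.
Qed.

Lemma fps_coefMXn f k n :
  fps_coef (f * fpsX ^+ k) n = if (n < k)%N then 0 else fps_coef f (n - k).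
Proof.
elim: k n => [|k IHk] n; first by rewrite expr0 mulr1 subn0.
by rewrite exprSr mulrA fps_coefMX; case: n => [|n] //; rewrite IHk.
Qed.

Lemma fps_coefMC f c n : fps_coef (f * fpsC c) n = fps_coef f n * c.
Proof.
rewrite mulrC fps_coefM big_ord_recl /= subn0 big1 ?addr0 1?mulrC // => i _.
by rewrite mul0r.
Qed.

Lemma fpsCM c d : fpsC (c * d) = fpsC c * fpsC d.
Proof. by apply: fpsP => -[|n]; rewrite fps_coefMC //= mul0r. Qed.

Lemma fpsCX c k : fpsC (c ^+ k) = fpsC c ^+ k.
Proof. by elim: k => // k IHk; rewrite !exprS fpsCM IHk. Qed.

(* The coefficients g_n of the inverse of f satisfy g_0 = f_0^-1 and
   g_(n+1) = - f_0^-1 * \sum_(i <= n) f_(i+1) g_(n-i); m is the fuel. *)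
Fixpoint fps_inv_rec f (m n : nat) : R :=
  if n isn't n'.+1 then (fps_coef f 0)^-1 else
  if m isn't m'.+1 then 0 else
  - (fps_coef f 0)^-1 *
    \sum_(i < n'.+1) fps_coef f i.+1 * fps_inv_rec f m' (n' - i).

Definition fps_unit : pred {fps R} :=
  fun f => fps_coef f 0 \is a GRing.unit.
Definition fps_inv f : {fps R} :=
  if fps_unit f then Fps (fun n => fps_inv_rec f n n) else f.

Lemma fps_inv_recE f m n : (n <= m)%N -> fps_inv_rec f m n = fps_inv_rec f n n.
Proof.
elim/ltn_ind: n m => -[|n] IHn [|m] //= nm; congr (_ * _).
apply: eq_bigr => i _; congr (_ * _).
have ni : (n - i <= n)%N by rewrite leq_subr.
by rewrite IHn ?[RHS]IHn // (leq_trans ni).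
Qed.

Fact fps_mulVf : {in fps_unit, left_inverse 1 fps_inv *%R}.
Proof.
move=> f fu; have uf : fps_coef f 0 \is a GRing.unit by [].
rewrite mulrC; apply: fpsP => n; rewrite fps_coefM fps_coef1 /fps_inv ifT //=.
case: n => [|n]; first by rewrite big_ord1 /= divrr.
rewrite big_ord_recl /= mulrA mulrN divrr // mulN1r addrC.
apply/eqP; rewrite subr_eq0; apply/eqP; apply: eq_bigr => i _.
by rewrite /bump /= add1n subSS [in RHS]fps_inv_recE // leq_subr.
Qed.

Fact fps_unitP f g : g * f = 1 -> fps_unit f.
Proof.
move=> /(congr1 (fun h => fps_coef h 0%N)).
rewrite fps_coefM big_ord1 subn0 fps_coef1 /= => gf1.
by apply/unitrP; exists (fps_coef g 0%N); rewrite gf1 mulrC gf1.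
Qed.

Fact fps_inv_out : {in [predC fps_unit], fps_inv =1 id}.
Proof.
move=> f nuf; have /negbTE uf : ~~ fps_unit f by [].
by rewrite /fps_inv uf.
Qed.

HB.instance Definition _ := GRing.ComNzRing_hasMulInverse.Build {fps R}
  fps_mulVf fps_unitP fps_inv_out.

Lemma fps_unitE f :
  (f \is a GRing.unit) = (fps_coef f 0 \is a GRing.unit).
Proof. by []. Qed.

End FpsRing.

Arguments fpsX {R}.

Definition qpoch (A : comUnitRingType) (a p : A) (k : nat) : A :=
  \prod_(i < k) (1 - a * p ^+ i).

Definition qbinom (A : comUnitRingType) (p : A) (m n : nat) : A :=
  qpoch p p m / (qpoch p p n * qpoch p p (m - n)).

(* R[[x, q]] is realised as R[[q]][[x]]: the coefficient of x^j q^n in f is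
   fps_coef (fps_coef f j) n. *)
Notation fps2 R := {fps {fps R}}.

Definition fps2x (R : comUnitRingType) : fps2 R := fpsX.
Definition fps2q (R : comUnitRingType) : fps2 R := fpsC fpsX.

Section Limits.
Variable R : comUnitRingType.
Implicit Types (u : nat -> fps2 R) (f g a p : fps2 R).

Definition fps2_coef f (j n : nat) : R := fps_coef (fps_coef f j) n.

(* Each coefficient of u_N is eventually equal to that of f: this is the usual
   topology of R[[x, q]], R being discrete. *)
Definition fps2_cvg u f : Prop :=
  forall j n, exists N0, forall N, (N0 <= N)%N ->
    fps2_coef (u N) j n = fps2_coef f j n.

(* The limit of u, or 0 if u diverges. *)
Definition fps2_lim u : fps2 R := xget 0 [set f | fps2_cvg u f]%classic.

Definition qpoch_inf a p : fps2 R := fps2_lim (qpoch a p).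

Lemma fps2_cvg_unique u f g : fps2_cvg u f -> fps2_cvg u g -> f = g.
Proof.
move=> uf ug; apply: fpsP => j; apply: fpsP => n.
have [N1 h1] := uf j n; have [N2 h2] := ug j n.
have := h1 _ (leq_maxl N1 N2); rewrite h2 ?leq_maxr // => ->.
Qed.

Lemma fps2_cvg_lim u f : fps2_cvg u f -> fps2_lim u = f.
Proof.
move=> uf; apply: xget_unique => // g ug; exact: fps2_cvg_unique ug uf.
Qed.

Lemma cvg_qpoch_inf t M : (0 < M)%N ->
  fps2_cvg (qpoch (fps2x R * fps2q R ^+ t) (fps2q R ^+ M))
           (qpoch_inf (fps2x R * fps2q R ^+ t) (fps2q R ^+ M)).
Proof.
move=> M0; set u := qpoch _ _.
have uS N j n : (n < N)%N -> fps2_coef (u N.+1) j n = fps2_coef (u N) j n.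
  move=> nN; rewrite /u /qpoch big_ord_recr /= -/(qpoch _ _ N).
  rewrite mulrBr mulr1 -exprM -!mulrA -exprD mulrA /fps2_coef !fps_coefB.
  rewrite /fps2q -[fpsC _ ^+ (t + _)]fpsCX fps_coefMC fps_coefMXn ifT ?subr0 //.
  rewrite (leq_trans nN) // (leq_trans _ (leq_addl _ _)) //.
  by rewrite leq_pmull.
have u_stable j n N : (n < N)%N -> fps2_coef (u N) j n = fps2_coef (u n.+1) j n.
  elim: N => // N IHN; rewrite ltnS leq_eqVlt => /predU1P[-> //|nN].
  by rewrite uS // IHN.
pose f : fps2 R := Fps (fun j => Fps (fun n => fps2_coef (u n.+1) j n)).
have uf : fps2_cvg u f by move=> j n; exists n.+1 => N /u_stable.
by rewrite /qpoch_inf (fps2_cvg_lim uf).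
Qed.

End Limits.

(* Main.v *)
(** With [p = q^M], [z = q^r] and [t = x q^s], the coefficients of [t^j] on the
    right-hand side are, after merging the base-[p^2] factorials, those of
      [A(t) B(t)],  [A(t) = \sum_k (-z;p)_k / (p;p)_k t^k],
                    [B(t) = \sum_m (z t)^(2m) / (p^2;p^2)_m].
    As [(1 - t) A(t) = (1 + z t) A(p t)] and [(1 - z^2 t^2) B(t) = B(p t)], the
    product [D = A B] satisfies [(1 - t) (1 - z t) D(t) = D(p t)].  Iterating,
    [(t;p)_N (z t;p)_N D(t) = D(p^N t)], which tends to [D(0) = 1]. *)
Require Import Defs.
From HB Require Import structures.
From mathcomp Require Import all_boot all_order all_algebra.
From mathcomp Require Import ring.
Set Implicit Arguments.
Unset Strict Implicit.
Unset Printing Implicit Defensive.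
Import GRing.Theory.
Local Open Scope ring_scope.

(** * Constant series as ring morphisms, and dilation of the variable *)

Lemma fps_coef_sum (R : comUnitRingType) (I : Type) (s : seq I)
    (F : I -> {fps R}) n :
  fps_coef (\sum_(i <- s) F i) n = \sum_(i <- s) fps_coef (F i) n.
Proof. by elim: s => [|i s IHs]; rewrite ?big_nil // !big_cons /= IHs. Qed.

Fact fpsC_is_zmod_morphism (R : comUnitRingType) : zmod_morphism (@fpsC R).
Proof. by move=> c d; apply: fpsP => -[|n] //=; rewrite subr0. Qed.

Fact fpsC_is_monoid_morphism (R : comUnitRingType) : monoid_morphism (@fpsC R).
Proof. by split=> // c d; rewrite fpsCM. Qed.

HB.instance Definition _ (R : comUnitRingType) :=
  GRing.isZmodMorphism.Build R {fps R} (@fpsC R) (@fpsC_is_zmod_morphism R).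
HB.instance Definition _ (R : comUnitRingType) :=
  GRing.isMonoidMorphism.Build R {fps R} (@fpsC R) (@fpsC_is_monoid_morphism R).

Lemma fpsCV (R : comUnitRingType) (c : R) : fpsC c^-1 = (fpsC c)^-1.
Proof.
have [cU|cNU] := boolP (c \is a GRing.unit); first exact: rmorphV.
by rewrite !invr_out // fps_unitE.
Qed.

(** The substitution of [c t] for the variable [t]. Acting on coefficients, it makes sense for every
    [c], without any convergence condition. *)
Definition fps_dilate (R : comUnitRingType) (c : R) (f : {fps R}) : {fps R} :=
  Fps (fun n => fps_coef f n * c ^+ n).

Lemma fps_coef_dilate (R : comUnitRingType) (c : R) (f : {fps R}) n :
  fps_coef (fps_dilate c f) n = fps_coef f n * c ^+ n.
Proof. by []. Qed.

Fact fps_dilate_is_zmod_morphism (R : comUnitRingType) (c : R) :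
  zmod_morphism (fps_dilate c).
Proof. by move=> f g; apply: fpsP => n /=; rewrite mulrBl. Qed.

Fact fps_dilate_is_monoid_morphism (R : comUnitRingType) (c : R) :
  monoid_morphism (fps_dilate c).
Proof.
split=> [|f g]; apply: fpsP => n.
  by case: n => [|n] /=; rewrite ?mulr1 ?mul0r.
rewrite fps_coefM [LHS]/= mulr_suml; apply: eq_bigr => i _ /=.
by rewrite mulrACA -exprD subnKC // -ltnS.
Qed.

HB.instance Definition _ (R : comUnitRingType) (c : R) :=
  GRing.isZmodMorphism.Build {fps R} {fps R} (fps_dilate c)
    (fps_dilate_is_zmod_morphism c).
HB.instance Definition _ (R : comUnitRingType) (c : R) :=
  GRing.isMonoidMorphism.Build {fps R} {fps R} (fps_dilate c)
    (fps_dilate_is_monoid_morphism c).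

Lemma fps_dilateX (R : comUnitRingType) (c : R) :
  fps_dilate c fpsX = fpsX * fpsC c.
Proof.
by apply: fpsP => n; rewrite fps_coefMC; case: n => [|[|n]] //=; rewrite !mul0r.
Qed.

Lemma fps_dilateC (R : comUnitRingType) (c d : R) :
  fps_dilate c (fpsC d) = fpsC d.
Proof. by apply: fpsP => -[|n] /=; rewrite ?mulr1 ?mul0r. Qed.

Lemma fps_dilate_comp (R : comUnitRingType) (c d : R) (f : {fps R}) :
  fps_dilate c (fps_dilate d f) = fps_dilate (c * d) f.
Proof. by apply: fpsP => n /=; rewrite exprMn mulrAC mulrA. Qed.

(** * Finite q-shifted factorials *)

Lemma qpochS (A : comUnitRingType) (a p : A) k :
  qpoch a p k.+1 = qpoch a p k * (1 - a * p ^+ k).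
Proof. by rewrite /qpoch big_ord_recr. Qed.

Lemma rmorph_qpoch (A B : comUnitRingType) (f : {rmorphism A -> B}) (a p : A) k :
  f (qpoch a p k) = qpoch (f a) (f p) k.
Proof.
rewrite /qpoch rmorph_prod; apply: eq_bigr => i _.
by rewrite rmorphB rmorph1 rmorphM rmorphXn.
Qed.

Lemma qpoch_unit (A : comUnitRingType) (p : A) k :
  (forall n, 1 - p ^+ n.+1 \is a GRing.unit) -> qpoch p p k \is a GRing.unit.
Proof.
move=> pU; elim: k => [|k IHk]; first by rewrite /qpoch big_ord0 unitr1.
by rewrite qpochS unitrM IHk -exprS pU.
Qed.

(** The factors with an even power of [p] form the first product, those with an odd power the
    second. When the length is odd, [e] gives the even powers their one extra factor. *)
Lemma qpoch_dissect (A : comUnitRingType) (a p : A) i (e : bool) :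
  qpoch a (p ^+ 2) (i + e) * qpoch (a * p) (p ^+ 2) i = qpoch a p (i.*2 + e).
Proof.
have even k : qpoch a (p ^+ 2) k * qpoch (a * p) (p ^+ 2) k = qpoch a p k.*2.
  elim: k => [|k IHk]; first by rewrite /qpoch !big_ord0 mulr1.
  rewrite doubleS !qpochS -IHk -!exprM -mul2n.
  rewrite [p ^+ (2 * k).+1]exprS; ring.
case: e; last by rewrite !addn0 even.
by rewrite !addn1 !qpochS mulrAC even -exprM mul2n.
Qed.

(** * The two factors of the generating series and their functional equations *)

Lemma sum_even (V : nmodType) (F : nat -> V) j :
  (\sum_(k < j.+1) if odd k then 0 else F k) = \sum_(i < (j./2).+1) F i.*2.
Proof.
elim: j => [|j IHj]; first by rewrite !big_ord_recr !big_ord0.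
rewrite big_ord_recr /= IHj uphalf_half.
have [oj|ej] := boolP (odd j); last by rewrite /= add0n addr0.
rewrite /= add1n [in RHS]big_ord_recr /=; congr (_ + F _).
by rewrite -[in LHS](odd_double_half j) oj doubleS.
Qed.

(** Formally, by the q-binomial theorem, the expansion of (-zt;p)_inf / (t;p)_inf. *)
Definition binomial_series (K : comUnitRingType) (p z : K) : {fps K} :=
  Fps (fun k => qpoch (- z) p k / qpoch p p k).

(** Formally, Euler's expansion of 1 / (z^2 t^2; p^2)_inf, whose denominator factors as (zt;p)_inf
    (-zt;p)_inf; the second factor cancels the numerator of [binomial_series]. *)
Definition even_euler_series (K : comUnitRingType) (p z : K) : {fps K} :=
  Fps (fun n => if odd n then 0
                else (z ^+ 2) ^+ n./2 / qpoch (p ^+ 2) (p ^+ 2) n./2).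

Lemma binomial_series_eq (K : comUnitRingType) (p z : K) :
  (forall n, 1 - p ^+ n.+1 \is a GRing.unit) ->
  let A := binomial_series p z in
  (1 - fpsX) * A = (1 + fpsX * fpsC z) * fps_dilate p A.
Proof.
move=> pU A.
have -> : (1 - fpsX) * A = A - A * fpsX by ring.
have -> : (1 + fpsX * fpsC z) * fps_dilate p A =
    fps_dilate p A + fps_dilate p A * fpsC z * fpsX by ring.
apply: fpsP => -[|n]; rewrite fps_coefB fps_coefD !fps_coefMX.
  by rewrite /= subr0 addr0 mulr1.
rewrite fps_coefMC ![fps_coef (fps_dilate _ _) _]/=.
(* This recurrence between consecutive coefficients is the coefficient of t^(n+1) in the functional
   equation, rearranged. *)
have AS : fps_coef A n.+1 * (1 - p ^+ n.+1) = fps_coef A n * (1 + z * p ^+ n).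
  rewrite /= !qpochS -exprS invrM ?qpoch_unit ?pU // mulrA mulrAC divrK //.
  by rewrite mulNr opprK mulrAC.
rewrite -[LHS]/(fps_coef A n.+1 - fps_coef A n).
rewrite -[X in _ = X * _ + _]/(fps_coef A n.+1) -[X in _ + X * _ * _]/(fps_coef A n).
have -> : fps_coef A n.+1 - fps_coef A n =
    fps_coef A n.+1 * (1 - p ^+ n.+1) + fps_coef A n.+1 * p ^+ n.+1 - fps_coef A n.
  ring.
rewrite AS; ring.
Qed.

Lemma even_euler_series_eq (K : comUnitRingType) (p z : K) :
  (forall n, 1 - p ^+ n.+1 \is a GRing.unit) ->
  let B := even_euler_series p z in
  (1 - (fpsX * fpsC z) ^+ 2) * B = fps_dilate p B.
Proof.
move=> pU B.
have -> : (1 - (fpsX * fpsC z) ^+ 2) * B = B - B * fpsC (z ^+ 2) * fpsX ^+ 2.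
  by rewrite rmorphXn; ring.
apply: fpsP => n; rewrite fps_coefB fps_coefMXn.
case: n => [|[|n]]; [by rewrite /= subr0 mulr1 | by rewrite /= subr0 mul0r |].
rewrite fps_coefMC subSS subSS subn0 /= negbK.
case: ifP => on; first by rewrite !mul0r subr0.
(* For even [n], p^(n+2) is the power [w] of [p ^+ 2] occurring in the last factor [1 - w] of the
   new denominator. *)
have en : n.+2 = (2 * (n./2).+1)%N.
  by rewrite mulnS mul2n -[in LHS](odd_double_half n) on.
have p2U k : 1 - (p ^+ 2) ^+ k.+1 \is a GRing.unit.
  by rewrite -exprM mulnS; apply: pU.
rewrite en exprM qpochS -exprS invrM ?qpoch_unit //.
set u := (qpoch _ _ _)^-1; set w := (p ^+ 2) ^+ (n./2).+1.
have wU : (1 - w) * (1 - w)^-1 = 1 by apply/divrr/p2U.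
rewrite [(z ^+ 2) ^+ _.+1]exprS.
(* The shifted coefficient lacks the factor [1 - w] in its denominator; inserting it above and below
   gives a common denominator. *)
by rewrite -[X in _ - X]mulr1 -[X in _ - _ * X]wU; ring.
Qed.

Lemma fps_unit_1DX (K : comUnitRingType) (z : K) :
  1 + fpsX * fpsC z \is a GRing.unit.
Proof.
by rewrite fps_unitE fps_coefD fps_coefMC /= mul0r addr0 unitr1.
Qed.

(** Multiplied by the unit 1 + zt, both sides agree: on the left it completes 1 - zt to the factor 1
    - z^2 t^2 of the second equation, and on the right it is the factor in the first. *)
Lemma two_part_series_eq (K : comUnitRingType) (p z : K) :
  (forall n, 1 - p ^+ n.+1 \is a GRing.unit) ->
  let D := binomial_series p z * even_euler_series p z in
  (1 - fpsX) * (1 - fpsX * fpsC z) * D = fps_dilate p D.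
Proof.
move=> pU D; apply: (mulrI (fps_unit_1DX z)).
rewrite /D rmorphM /= [RHS]mulrA -(binomial_series_eq z pU).
rewrite -(even_euler_series_eq z pU).
ring.
Qed.

Lemma coef_two_part_series (K : comUnitRingType) (p z : K) j :
  (forall n, 1 - p ^+ n.+1 \is a GRing.unit) ->
  fps_coef (binomial_series p z * even_euler_series p z) j =
  (qpoch (p ^+ 2) (p ^+ 2) j./2)^-1 *
  \sum_(i < (j./2).+1) qbinom (p ^+ 2) j./2 i *
    (qpoch (- z) (p ^+ 2) (i + odd j) * qpoch (- (z * p)) (p ^+ 2) i /
     qpoch p (p ^+ 2) (i + odd j)) * (z ^+ 2) ^+ (j./2 - i).
Proof.
move=> pU; rewrite mulrC fps_coefM.
pose F k := (z ^+ 2) ^+ k./2 / qpoch (p ^+ 2) (p ^+ 2) k./2 *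
  (qpoch (- z) p (j - k) / qpoch p p (j - k)).
transitivity (\sum_(k < j.+1) if odd k then 0 else F k).
  by apply: eq_bigr => k _ /=; case: ifP; rewrite ?mul0r.
(* Only even degrees 2k of the Euler factor survive. Setting k = floor(j/2) - i leaves degree 2i +
   (j mod 2) for the other factor, which [qpoch_dissect] splits into base [p ^+ 2]. *)
rewrite sum_even (reindex_inj rev_ord_inj) mulr_sumr /=; apply: eq_bigr => i _.
have im : (i <= j./2)%N by rewrite -ltnS.
have p2U k : qpoch (p ^+ 2) (p ^+ 2) k \is a GRing.unit.
  by apply: qpoch_unit => n; rewrite -exprM mulnS; apply: pU.
have pE : qpoch p (p ^+ 2) (i + odd j) * qpoch (p ^+ 2) (p ^+ 2) i =
    qpoch p p (i.*2 + odd j).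
  by rewrite -qpoch_dissect expr2.
have pE2 : qpoch p (p ^+ 2) (i + odd j) \is a GRing.unit.
  by have := qpoch_unit (i.*2 + odd j) pU; rewrite -pE unitrM => /andP[].
rewrite subSS /F doubleK.
have -> : (j - (j./2 - i).*2 = i.*2 + odd j)%N.
  rewrite -[X in (X - _)%N](odd_double_half j) doubleB subnBA ?leq_double //.
  by rewrite addnAC addnK addnC.
rewrite -pE -qpoch_dissect mulNr /qbinom.
move: (p2U j./2) (p2U i) (p2U (j./2 - i)%N) pE2.
move: (qpoch (p ^+ 2) _ j./2) (qpoch (p ^+ 2) _ i) (qpoch (p ^+ 2) _ (_ - i)).
move: (qpoch p _ _) (qpoch (- z) _ _) (qpoch (- (z * p)) _ _) ((z ^+ 2) ^+ _).
move=> a b c d e f g eU fU gU aU.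
rewrite !invrM ?unitrM ?fU ?gU //.
(* Here [e] is the numerator of the Gaussian binomial, cancelled by the prefactor of the sum. *)
transitivity (e^-1 * e * (d / g * (b * c * (f^-1 / a)))); last by ring.
by rewrite mulVr // mul1r.
Qed.

Lemma qpoch_dilate (K : comUnitRingType) (p a b : K) (D : {fps K}) N :
  (1 - fpsX * fpsC a) * (1 - fpsX * fpsC b) * D = fps_dilate p D ->
  qpoch (fpsX * fpsC a) (fpsC p) N * qpoch (fpsX * fpsC b) (fpsC p) N * D =
  fps_dilate (p ^+ N) D.
Proof.
move=> Deq; elim: N => [|N IHN].
  by rewrite /qpoch !big_ord0 !mul1r; apply: fpsP => n /=; rewrite expr1n mulr1.
(* Dilating the functional equation by p^N turns its two linear factors into the last factors of the
   two products of length N + 1. *)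
rewrite exprSr -fps_dilate_comp -Deq !rmorphM !rmorphB rmorph1 !rmorphM /=.
by rewrite -IHN !fps_dilateC fps_dilateX !qpochS rmorphXn; ring.
Qed.

(** * Constant terms and coefficientwise limits *)

Lemma fps_coef_Xn (R : comUnitRingType) k n :
  fps_coef (fpsX ^+ k : {fps R}) n = (n == k)%:R.
Proof.
rewrite -[fpsX ^+ k]mul1r fps_coefMXn fps_coef1 subn_eq0 eqn_leq.
by case: ltnP; rewrite ?andbT ?andbF.
Qed.

Lemma coef0_two_part_series (K : comUnitRingType) (p z : K) :
  fps_coef (binomial_series p z * even_euler_series p z) 0 = 1.
Proof. by rewrite fps_coefM big_ord1 /= /qpoch !big_ord0 !divr1 mul1r. Qed.

(** A coefficient of a product depends only on the finitely many coefficients of smaller or equal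
    bidegree, so the maximum of their thresholds serves for all of them. *)
Lemma fps2_cvgM (R : comUnitRingType) (u v : nat -> fps2 R) (f g : fps2 R) :
  fps2_cvg u f -> fps2_cvg v g -> fps2_cvg (fun N => u N * v N) (f * g).
Proof.
have unif (w : nat -> fps2 R) h : fps2_cvg w h -> forall j n, exists N0,
    forall N, (N0 <= N)%N -> forall i k, (i <= j)%N -> (k <= n)%N ->
    fps2_coef (w N) i k = fps2_coef h i k.
  move=> wh j n; have {}wh i k := wh i k.
  have [N0 N0P] := boolp.choice (fun ik => wh ik.1 ik.2).
  exists (\max_(i < j.+1) \max_(k < n.+1) N0 (val i, val k))%N => N NN i k.
  rewrite -ltnS => ij; rewrite -ltnS => kn.
  apply: (N0P (i, k)); apply: leq_trans NN.
  apply: leq_trans (leq_bigmax (Ordinal ij)).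
  exact: (leq_bigmax (Ordinal kn)).
move=> uf vg j n.
have [N1 h1] := unif _ _ uf j n; have [N2 h2] := unif _ _ vg j n.
exists (maxn N1 N2) => N; rewrite geq_max => /andP[NN1 NN2].
rewrite /fps2_coef !fps_coefM !fps_coef_sum.
apply: eq_bigr => i _; rewrite !fps_coefM; apply: eq_bigr => k _.
by congr (_ * _); [apply: h1 | apply: h2]; rewrite // ?leq_subr // -ltnS.
Qed.

Lemma fps2_cvg_sum (R : comUnitRingType) (f : fps2 R) :
  fps2_cvg (fun N => \sum_(j < N) fpsX ^+ j * fpsC (fps_coef f j)) f.
Proof.
move=> j n; exists j.+1 => N jN; rewrite /fps2_coef fps_coef_sum.
rewrite (bigD1 (Ordinal jN)) // big1 ?Monoid.mulm1 => [|i neq].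
  by rewrite fps_coefMC fps_coef_Xn eqxx mul1r.
have /negPf ij : j != i by move: neq; rewrite -val_eqE eq_sym.
by rewrite fps_coefMC fps_coef_Xn ij mul0r.
Qed.

(** In positive x-degree the dilation multiplies the coefficient by a power of q of exponent at
    least N, which kills the coefficient of q^n once N > n. *)
Lemma fps2_cvg_dilate (R : comUnitRingType) (M : nat) (f : fps2 R) :
  (0 < M)%N ->
  fps2_cvg (fun N => fps_dilate ((fpsX ^+ M) ^+ N) f) (fpsC (fps_coef f 0)).
Proof.
move=> M0 [|j] n; exists n.+1 => N nN; rewrite /fps2_coef fps_coef_dilate.
  by rewrite mulr1.
rewrite -!exprM fps_coefMXn ifT //; apply: leq_trans nN _.
by rewrite mulnAC leq_pmull // muln_gt0 M0.
Qed.

Theorem theorem5p2 (R : comUnitRingType) (s M r : nat)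
    (s_gt0 : (0 < s)%N) (M_gt0 : (0 < M)%N) (srM : (s + r <= M)%N) :
  let x : fps2 R := fps2x R in
  let q : fps2 R := fps2q R in
  fps2_cvg
    (fun N : nat => \sum_(j < N)
       x ^+ j * q ^+ (s * j) / qpoch (q ^+ (2 * M)) (q ^+ (2 * M)) j./2 *
       \sum_(i < (j./2).+1)
          qbinom (q ^+ (2 * M)) j./2 i *
          (qpoch (- q ^+ r) (q ^+ (2 * M)) (i + (uphalf j - j./2)) *
           qpoch (- q ^+ (M + r)) (q ^+ (2 * M)) i /
           qpoch (q ^+ M) (q ^+ (2 * M)) (i + (uphalf j - j./2))) *
          (q ^+ (2 * r)) ^+ (j./2 - i))
    (1 / (qpoch_inf (x * q ^+ s) (q ^+ M) *
          qpoch_inf (x * q ^+ (s + r)) (q ^+ M))).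
Proof.
move=> x q.
pose p : {fps R} := fpsX ^+ M; pose z : {fps R} := fpsX ^+ r.
pose c : {fps R} := fpsX ^+ s.
have qE k : q ^+ k = fpsC (fpsX ^+ k) by rewrite fpsCX.
have pU n : 1 - p ^+ n.+1 \is a GRing.unit.
  rewrite fps_unitE fps_coefB -exprM fps_coef_Xn.
  by rewrite eq_sym muln_eq0 orbF (gtn_eqF M_gt0) subr0 unitr1.
pose D := binomial_series p z * even_euler_series p z.
pose E := fps_dilate c D.
(* [E] is D(t) at t = x q^s. Dilations by [p] and [c] commute, so dilating the equation of [D] by
   [c] gives that of [E]. *)
have Eeq : (1 - fpsX * fpsC c) * (1 - fpsX * fpsC (c * z)) * E = fps_dilate p E.
  have -> : fps_dilate p E = fps_dilate c (fps_dilate p D).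
    by rewrite /E !fps_dilate_comp [p * c]mulrC.
  rewrite -(two_part_series_eq z pU) -/D.
  rewrite !rmorphM !rmorphB rmorph1 rmorphM.
  by rewrite /= fps_dilateC fps_dilateX [fpsX * (_ * _)]mulrA [E]rmorphM.
have D0 : fps_coef D 0 = 1 by exact: coef0_two_part_series.
have PE : qpoch_inf (x * q ^+ s) (q ^+ M) *
          qpoch_inf (x * q ^+ (s + r)) (q ^+ M) * E = 1.
  (* The sequence E(p^N x) equals the finite products times [E], so it tends both to the infinite
     products times [E] and to the constant term of [E], which is 1. *)
  apply: (@fps2_cvg_unique _ (fun N => fps_dilate (p ^+ N) E)); last first.
    have -> : 1 = fpsC (fps_coef E 0) :> fps2 R.
      by rewrite fps_coef_dilate D0 mulr1.
    exact: fps2_cvg_dilate.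
  have cE : fps2_cvg (fun=> E) E by move=> j n; exists 0%N.
  move=> j n; have [N0 h] :=
    fps2_cvgM (fps2_cvgM (cvg_qpoch_inf R s M_gt0) (cvg_qpoch_inf R (s + r) M_gt0))
              cE j n.
  by exists N0 => N /h <-; rewrite -(qpoch_dilate N Eeq) -exprD !qE.
rewrite div1r (mulr1_eq PE).
(* The inverse is [E], the limit of its own partial sums in x; it remains to match the terms one by
   one. *)
move=> j n; have [N0 h] := fps2_cvg_sum E j n.
exists N0 => N /h <-; congr fps2_coef; apply: eq_bigr => k _.
(* The ceiling of k/2 minus its floor is the parity of [k]. *)
rewrite fps_coef_dilate coef_two_part_series // uphalf_half addnK.
rewrite exprM qE -rmorphXn -!mulrA; congr (_ * _).
have q2M : q ^+ (2 * M) = fpsC (p ^+ 2) by rewrite qE mulnC exprM.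
have q2r : q ^+ (2 * r) = fpsC (z ^+ 2) by rewrite qE mulnC exprM.
have qMr : q ^+ (M + r) = fpsC (z * p) by rewrite qE addnC exprD.
have qpE a b m : fpsC (qpoch a b m) = qpoch (fpsC a) (fpsC b) m :> fps2 R.
  exact: rmorph_qpoch.
rewrite mulrC [RHS]rmorphM [X in _ = _ * X]rmorphM -mulrA.
rewrite q2M q2r qMr !qE -/p -/z.
congr (_ * _); first by rewrite /= fpsCV qpE.
congr (_ * _).
rewrite rmorph_sum; apply: eq_bigr => i _ /=.
clearbody p z.
have fpsCN a : fpsC (- a) = - fpsC a :> fps2 R by rewrite rmorphN.
by rewrite !fpsCM !fpsCV !fpsCM !qpE !fpsCN ?fpsCM !fpsCX.
Qed.
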